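(* Let $A\in\mathbb{R}^{n\times n}$ be a symmetric matrix whose associated signed weighted undirected graph $\mathcal{G}(A)$ is connected and acyclic (a tree), and let $B=\mathbf{e}_1\in\mathbb{R}^n$, so that vertex $1$ is the only leader and the vertices $2,\dots,n$ are the followers. Suppose that all the followers have distance one from the leader. Then the pair $(A,B)$ is herdable if and only if all the edges of $\mathcal{G}(A)$ have the same sign.
   Context: $\mathbf{e}_1$ is the first canonical basis vector. $\mathcal{G}(A)$ has vertex set $\{1,\dots,n\}$ and an arc $(j,i)$ from $j$ to $i$, of weight $[A]_{ij}$, if and only if $[A]_{ij}\neq0$; for symmetric $A$ it is an undirected graph, and acyclicity excludes self-loops (zero diagonal). The sign of an edge is the sign of its weight. Distance is the minimal length of a walk. Herdability: the pair $(A,B)$ describes the linear time-invariant system $\dot{\mathbf{x}}(t)=A\mathbf{x}(t)+B\mathbf{u}(t)$ (or its discrete-time counterpart $\mathbf{x}(t+1)=A\mathbf{x}(t)+B\mathbf{u}(t)$). The pair is (completely) herdable if for every $\mathbf{x}(0)$ and every $h>0$ there exist a time $t_f>0$ and an input $\mathbf{u}(t)$, $t\in[0,t_f)$, driving the state from $\mathbf{x}(0)$ to some $\mathbf{x}(t_f)\ge h\mathbf{1}_n$ (entrywise, $\mathbf{1}_n$ the all-ones vector). It is known that (in both continuous and discrete time) this is equivalent to the image (column space) of the controllability matrix $[B\,|\,AB\,|\,\cdots\,|\,A^{n-1}B]$ containing a vector all of whose entries are positive. *)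

(* Defs.v *)
From mathcomp Require Import all_boot all_order all_algebra.
From mathcomp Require Import all_classical all_reals all_analysis.

Set Implicit Arguments.
Unset Strict Implicit.
Unset Printing Implicit Defensive.

Import Order.TTheory GRing.Theory Num.Theory.
Import numFieldNormedType.Exports.

Local Open Scope classical_set_scope.
Local Open Scope ring_scope.

Section Graphs.
Variables (T : finType) (e : rel T).

(* Cycles are simple.  In a symmetric graph, x - y - x is a ucycle of size 2
   which is just an edge walked back and forth, hence the bound on the size. *)
Definition acyclic : Prop :=
  irreflexive e /\ forall c : seq T, (2 < size c)%N -> ~ ucycle e c.

Definition connected_graph : Prop := forall x y : T, connect e x y.

Definition walk (x y : T) (k : nat) : Prop :=
  exists p : seq T, [/\ path e x p, last x p = y & size p = k].

Definition is_distance (x y : T) (d : nat) : Prop :=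
  walk x y d /\ forall k : nat, walk x y k -> (d <= k)%N.

End Graphs.

(* [A]_{ij} weighs the arc from j to i. *)
Definition mxgraph (R : realType) (n : nat) (A : 'M[R]_n) : rel 'I_n :=
  fun j i => A i j != 0.

Definition same_sign_edges (R : realType) (n : nat) (A : 'M[R]_n) : Prop :=
  forall j i l k : 'I_n, mxgraph A j i -> mxgraph A l k ->
    Num.sg (A i j) = Num.sg (A k l).

Section Herdability.
Variables (R : realType) (n m : nat) (A : 'M[R]_n) (B : 'M[R]_(n, m)).

(* x' = A x + B u on [0, tf] in the sense of Caratheodory, i.e. in integral
   form, for an integrable input on [0, tf[. *)
Definition ct_trajectory (tf : R) (u : R -> 'cV[R]_m) (x : R -> 'cV[R]_n) :
    Prop :=
  [/\ forall k : 'I_m,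
        (@lebesgue_measure R).-integrable `[0, tf[ (fun s : R => (u s k 0)%:E),
      forall i : 'I_n, {within `[0, tf], continuous (fun t : R => x t i 0)}
    & forall (t : R) (i : 'I_n), 0 <= t <= tf ->
        x t i 0 = x 0 i 0 +
          \int[@lebesgue_measure R]_(s in `[0, t[) (A *m x s + B *m u s) i 0].

Definition ct_herdable : Prop :=
  forall (x0 : 'cV[R]_n) (h : R), 0 < h ->
    exists (tf : R) (u : R -> 'cV[R]_m) (x : R -> 'cV[R]_n),
      [/\ 0 < tf, ct_trajectory tf u x, x 0 = x0
        & forall i : 'I_n, h <= x tf i 0].

Definition dt_trajectory (tf : nat) (u : nat -> 'cV[R]_m)
    (x : nat -> 'cV[R]_n) : Prop :=
  forall t : nat, (t < tf)%N -> x t.+1 = A *m x t + B *m u t.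

Definition dt_herdable : Prop :=
  forall (x0 : 'cV[R]_n) (h : R), 0 < h ->
    exists (tf : nat) (u : nat -> 'cV[R]_m) (x : nat -> 'cV[R]_n),
      [/\ (0 < tf)%N, dt_trajectory tf u x, x 0%N = x0
        & forall i : 'I_n, h <= x tf i 0].

End Herdability.

(* Main.v *)
Require Import Defs.
From mathcomp Require Import all_boot all_order all_algebra.
From mathcomp Require Import all_classical all_reals all_analysis.
From mathcomp Require Import ring.

(** Vertices at distance one from the leader of a tree are leaves attached to
it: an edge between two of them would close a triangle with the leader.  So the
graph is a star, and the dynamics read
  x_0' = sum_k A_{0k} x_k + u,     x_i' = A_{i0} x_0  for each follower i.

Every follower thus integrates the same signal x_0, up to its own weight.
Started at the origin, follower i ends at A_{i0} c, where c is the integral of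
x_0 over the time interval, or the last-but-one value of x_0 in discrete time.
If all these values are positive then all the A_{i0} have the sign of c.

Conversely, if one c makes all the A_{i0} c positive, a multiple d of c makes
the A_{i0} d exceed any prescribed bounds.  Since the input acts on x_0 without
restriction, it can cancel the feedback of the followers and impose the
trajectory of the leader.  In discrete time two steps suffice: x_0 goes to d,
then to h.  In continuous time x_0 is imposed on [0, 1] as the derivative of a
polynomial P with P(0) = 0 and P(1) = d, the values P'(0) and P'(1) being the
initial value of the leader and the target h; then everything is polynomial in
time and the integral equations hold by the fundamental theorem of calculus.

Both equivalences go through the same condition, the existence of a c such
that A_{i0} c > 0 for all followers i ([leader_star_same_signP]); they are
[star_dt_herdableP] and [star_ct_herdableP]. *)

Set Implicit Arguments.
Unset Strict Implicit.
Unset Printing Implicit Defensive.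

Import Order.TTheory GRing.Theory Num.Theory.
Import numFieldNormedType.Exports.

Local Open Scope classical_set_scope.
Local Open Scope ring_scope.

(** Stated over any ring, because the continuous-time construction computes
with matrices and states whose entries are polynomials in the time. *)
Definition leader_star (R : nzRingType) (n : nat) (A : 'M[R]_n.+1) : Prop :=
  [/\ A^T = A, A ord0 ord0 = 0, forall i, i != ord0 -> A i ord0 != 0
    & forall i j, i != ord0 -> j != ord0 -> A i j = 0].

(** An edge between two followers would make a triangle with the leader. *)
Lemma leader_star_of_graph (R : realType) (n : nat) (A : 'M[R]_n.+1) :
    A^T = A -> acyclic (mxgraph A) ->
    (forall i, i != ord0 -> is_distance (mxgraph A) ord0 i 1%N) ->
  leader_star A.
Proof.
move=> symA [irrA acyA] dist1.
have Aii i : A i i = 0 by apply/eqP; have := irrA i => /negPn.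
have edge i : i != ord0 -> A i ord0 != 0.
  by move=> /dist1[[[|k [|? ?]] [//= + <-] //] _]; rewrite andbT.
have sA i j : A i j = A j i by rewrite -[in LHS]symA mxE.
split=> //.
move=> i j i0 j0; apply: contrapT => /eqP Aij.
have ij : i != j by apply: contra_neq Aij => ->.
apply: (acyA [:: ord0; i; j]) => //; rewrite /ucycle /cycle /= /mxgraph.
rewrite edge// (sA j) Aij (sA ord0) edge//=.
by rewrite !inE negb_or ij !(eq_sym ord0) i0 j0.
Qed.

Lemma leader_star_polyC (R : nzRingType) (n : nat) (A : 'M[R]_n.+1) :
  leader_star A -> leader_star (map_mx polyC A).
Proof.
move=> [symA A00 edge AF0]; split=> [||i i0|i j i0 j0].
- by rewrite map_trmx symA.
- by rewrite mxE A00.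
- by rewrite mxE polyC_eq0 edge.
- by rewrite mxE AF0.
Qed.

(** A single scalar [c] witnesses the common sign.  When all signs agree, the
sum of the leader column is such a witness, which needs no special case for a
leader without followers. *)
Lemma leader_star_same_signP (R : realType) (n : nat) (A : 'M[R]_n.+1) :
    leader_star A ->
  same_sign_edges A <-> exists c, forall i, i != ord0 -> 0 < A i ord0 * c.
Proof.
move=> [symA A00 edge AF0]; split=> [sameA|[c cP]].
  exists (\sum_k A k ord0) => i i0.
  rewrite mulr_sumr (bigD1 i)//= ltr_wpDr//.
    apply: sumr_ge0 => k _; have [->|Ak0] := eqVneq (A k ord0) 0.
      by rewrite mulr0.
    by rewrite -sgr_ge0 sgrM (sameA _ _ _ _ (edge i i0) Ak0) -expr2 sqr_ge0.
  by rewrite -expr2 exprn_even_gt0//= edge.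
have leaf_sg i : i != ord0 -> Num.sg (A i ord0) = Num.sg c.
  move=> /cP /gtr0_sg; rewrite sgrM.
  case: (sgrP c); rewrite ?mulr0 ?mulr1 ?mulrN1// => _.
    by move=> /eqP; rewrite eq_sym oner_eq0.
  by move/eqP; rewrite eqr_oppLR => /eqP.
have edge_sg i j : mxgraph A j i -> Num.sg (A i j) = Num.sg c.
  rewrite /mxgraph; have [->|i0] := eqVneq i ord0; last first.
    by have [->|j0] := eqVneq j ord0; [rewrite leaf_sg | rewrite AF0 ?eqxx].
  have [->|j0] := eqVneq j ord0; first by rewrite A00 eqxx.
  by rewrite -symA mxE leaf_sg.
by move=> j i l k /edge_sg-> /edge_sg->.
Qed.

(** The multiple of [c] is a sum of nonnegative factors, one per index: each
factor meets its own bound, and the others can only push further up. *)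
Lemma scale_above (R : realType) (I : finType) (P : pred I) (w b : I -> R)
    (c : R) :
    (forall i, P i -> 0 < w i * c) ->
  exists d, forall i, P i -> b i <= w i * d.
Proof.
move=> wc; exists (c * \sum_(j | P j) `|b j| / (w j * c)) => i Pi.
rewrite mulrA; apply: le_trans (ler_norm _) _.
rewrite mulr_sumr (bigD1 i)//= mulrC divfK ?lt0r_neq0 ?wc//.
rewrite lerDl sumr_ge0// => j /andP[Pj _].
by rewrite mulr_ge0 ?divr_ge0// ltW// wc.
Qed.

Lemma leader_input_leader (R : nzRingType) (n : nat) (A : 'M[R]_n.+1)
    (x : 'cV[R]_n.+1) (v : 'cV[R]_1) :
  (A *m x + delta_mx ord0 0 *m v) ord0 0 = (A *m x) ord0 0 + v 0 0.
Proof. by rewrite !mxE big_ord1 mxE !eqxx mul1r. Qed.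

Lemma leader_input_follower (R : nzRingType) (n : nat) (A : 'M[R]_n.+1)
    (x : 'cV[R]_n.+1) (v : 'cV[R]_1) (i : 'I_n.+1) :
    leader_star A -> i != ord0 ->
  (A *m x + delta_mx ord0 0 *m v) i 0 = A i ord0 * x ord0 0.
Proof.
move=> [_ _ _ AF0] i0; rewrite !mxE big_ord1 mxE (negPf i0) mul0r addr0.
rewrite (bigD1 ord0)//= big1 ?addr0// => k k0.
by rewrite AF0 ?mul0r.
Qed.

(** A follower at time [t.+1] is its weight times the leader at time [t], so
the leader just before the final time has the required sign.  Conversely, the
leader is set to [d] at time 1, which lifts all the followers at time 2, when
the leader itself is set to [h]. *)
Lemma star_dt_herdableP (R : realType) (n : nat) (A : 'M[R]_n.+1) :
    leader_star A ->
  dt_herdable A (delta_mx ord0 0 : 'cV_n.+1) <->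
  exists c, forall i, i != ord0 -> 0 < A i ord0 * c.
Proof.
move=> starA; split=> [/(_ 0 1 ltr01)|[c cP] x0 h h0].
  move=> [[|t] [u [x [// _ trx _ xh]]]]; exists (x t ord0 0) => i i0.
  by move: (xh i); rewrite trx// leader_input_follower//; exact: lt_le_trans.
have [d dP] := scale_above (fun=> h) cP.
pose x1 : 'cV[R]_n.+1 :=
  \col_i if i == ord0 then d else A i ord0 * x0 ord0 0.
pose x2 : 'cV[R]_n.+1 := \col_i if i == ord0 then h else A i ord0 * d.
pose x t := if t is t'.+1 then if t' is 0%N then x1 else x2 else x0.
(* The input cancels the feedback on the leader and imposes its next value. *)
exists 2, (fun t => (x t.+1 ord0 0 - (A *m x t) ord0 0)%:M), x; split=> //.
  move=> t t2; apply/colP => i; have [->|i0] := eqVneq i ord0.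
    by rewrite leader_input_leader [X in _ + X]mxE eqxx addrC subrK.
  rewrite leader_input_follower//.
  by case: t t2 => [|[|//]] _; rewrite !mxE (negPf i0).
by move=> i; rewrite mxE; case: eqVneq => // i0; exact: dP.
Qed.

Lemma continuous_integrable_itvco (R : realType) (a b : R) (f : R -> R) :
    {within `[a, b], continuous f} ->
  (@lebesgue_measure R).-integrable `[a, b[ (EFin \o f).
Proof.
move=> cf; apply: (@integrableS _ _ R (@lebesgue_measure R) `[a, b]) => //.
  by apply: subset_itvl; rewrite bnd_simp.
by apply: continuous_compact_integrable => //; exact: segment_compact.
Qed.

Lemma Rintegral_deriv_poly (R : realType) (p : {poly R}) (t : R) :
    0 <= t ->
  \int[@lebesgue_measure R]_(s in `[0, t[) p^`().[s] = p.[t] - p.[0].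
Proof.
rewrite le_eqVlt => /predU1P[<-|t0].
  by rewrite set_itvco0 Rintegral_set0 subrr.
rewrite Rintegral_itv_bndo_bndc; last first.
  exact/continuous_integrable_itvco/continuous_subspaceT/continuous_horner.
rewrite /Rintegral (@continuous_FTC2 _ _ (horner p))//.
- exact/continuous_subspaceT/continuous_horner.
- split; first by move=> x _; exact: derivable_horner.
  + exact/cvg_at_right_filter/continuous_horner.
  + exact/cvg_at_left_filter/continuous_horner.
- by move=> x _; rewrite -derivE.
Qed.

(** Polynomial solutions of the differential equation, checked formally on
coefficients, are trajectories in the integral sense; this avoids any
analytic construction of solutions. *)
Lemma poly_ct_trajectory (R : realType) (n m : nat) (A : 'M[R]_n)
    (B : 'M[R]_(n, m)) (tf : R) (X : 'cV[{poly R}]_n)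
    (U : 'cV[{poly R}]_m) :
    map_mx (@deriv R) X = map_mx polyC A *m X + map_mx polyC B *m U ->
  ct_trajectory A B tf
    (fun s => map_mx (horner_eval s) U) (fun s => map_mx (horner_eval s) X).
Proof.
move=> dX; split=> [k|i|t i /andP[t0 _]].
- apply: continuous_integrable_itvco; apply: continuous_subspaceT.
  under eq_fun do rewrite mxE; exact: continuous_horner.
- apply: continuous_subspaceT.
  under eq_fun do rewrite mxE; exact: continuous_horner.
- have fieldE s :
      A *m map_mx (horner_eval s) X + B *m map_mx (horner_eval s) U =
      map_mx (horner_eval s) (map_mx (@deriv R) X).
    have evalC p q (M : 'M[R]_(p, q)) :
      map_mx (horner_eval s) (map_mx polyC M) = M.
      by apply/matrixP => k l; rewrite !mxE /horner_eval hornerC.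
    by rewrite dX map_mxD !map_mxM !evalC.
  under eq_Rintegral do rewrite fieldE !mxE.
  by rewrite !mxE Rintegral_deriv_poly// addrC subrK.
Qed.

(** The four conditions determine one cubic, whose coefficients are those
below. *)
Lemma hermite_interpolation01 (R : realType) (a d h : R) :
  exists P : {poly R},
    [/\ P.[0] = 0, P.[1] = d, P^`().[0] = a & P^`().[1] = h].
Proof.
pose b := 3 * d - 2 * a - h; pose c := h + a - 2 * d.
exists (((c%:P * 'X + b%:P) * 'X + a%:P) * 'X).
rewrite !(derivM, derivD, derivC, derivX) -polyC1.
rewrite !(hornerD, hornerM, hornerX, hornerC).
by split; rewrite /b /c; ring.
Qed.

(** From the origin, a follower ends at its weight times the integral of the
leader.  Conversely, the leader follows [P^`()], so that each follower moves by
its weight times [P] whatever the other weights are. *)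
Lemma star_ct_herdableP (R : realType) (n : nat) (A : 'M[R]_n.+1) :
    leader_star A ->
  ct_herdable A (delta_mx ord0 0 : 'cV_n.+1) <->
  exists c, forall i, i != ord0 -> 0 < A i ord0 * c.
Proof.
move=> starA; split=> [/(_ 0 1 ltr01)|[c cP] x0 h h0].
  move=> [tf [u [x [tf0 [_ xcont xint] x00 xh]]]].
  exists (\int[@lebesgue_measure R]_(s in `[0, tf[) x s ord0 0) => i i0.
  have tf_in : 0 <= tf <= tf by rewrite lexx ltW.
  move: (xh i); rewrite (xint _ _ tf_in) x00 mxE add0r.
  under eq_Rintegral do rewrite leader_input_follower//.
  rewrite RintegralZl//; first exact: lt_le_trans.
  exact: continuous_integrable_itvco.
have [d dP] := scale_above (fun i => h - x0 i 0) cP.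
have [P [P0 P1 dP0 dP1]] := hermite_interpolation01 (x0 ord0 0) d h.
pose X : 'cV[{poly R}]_n.+1 :=
  \col_i if i == ord0 then P^`() else (x0 i 0)%:P + A i ord0 *: P.
(* The input cancels the feedback on the leader and imposes its velocity. *)
pose u : {poly R} := P^`()^`() - (map_mx polyC A *m X) ord0 0.
exists 1, (fun s => map_mx (horner_eval s) (u%:M)),
  (fun s => map_mx (horner_eval s) X); split=> //.
- apply: poly_ct_trajectory; rewrite map_delta_mx.
  apply/colP => i; rewrite mxE; have [->|i0] := eqVneq i ord0.
    by rewrite leader_input_leader [X in _ + X]mxE eqxx mxE eqxx addrC subrK.
  rewrite leader_input_follower//; last exact: leader_star_polyC.
  by rewrite !mxE (negPf i0) derivD derivC add0r derivZ mul_polyC.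
- apply/colP => i; rewrite !mxE /horner_eval.
  by case: eqVneq => [->//|_]; rewrite !hornerE P0 mulr0 addr0.
- move=> i; rewrite !mxE /horner_eval.
  case: eqVneq => [_|i0]; first by rewrite dP1.
  by rewrite !hornerE P1 -lerBlDl dP.
Qed.

Theorem proposition13 (R : realType) (n : nat) (A : 'M[R]_n.+1)
  (symA : A^T = A)
  (connA : connected_graph (mxgraph A))
  (acycA : acyclic (mxgraph A))
  (dist1 : forall i : 'I_n.+1, i != ord0 -> is_distance (mxgraph A) ord0 i 1%N) :
  let B : 'cV[R]_n.+1 := delta_mx ord0 0 in
  (ct_herdable A B <-> same_sign_edges A) /\
  (dt_herdable A B <-> same_sign_edges A).
Proof.
have starA := leader_star_of_graph symA acycA dist1.
have signP := leader_star_same_signP starA.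
split; apply: iff_trans (iff_sym signP).
- exact: star_ct_herdableP.
- exact: star_dt_herdableP.
Qed.
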